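(* Assume: (1) there is a modulus of continuity $\omega$ such that $|b(x,\alpha)-b(y,\alpha)|\le \omega(|x-y|)$ for all $x,y\in\overline\Omega$, $\alpha\in A$; (2) there are $\beta\in(1/2,1]$ and $B>0$ such that $|\sigma(x,\alpha)-\sigma(y,\alpha)|\le B|x-y|^\beta$ for all $x,y\in\overline\Omega$, $\alpha\in A$; (3) there exist $\delta,k>0$ and $\gamma<2\beta-1$ such that for every $\overline x\in\partial\Omega$ there is $\overline\alpha\in A$ for which $\sigma^T(\overline x,\overline\alpha)Dd(\overline x)=0$ and $$b(x,\overline\alpha)\cdot Dd(x)+\operatorname{tr}\big(a(x,\overline\alpha)D^2d(x)\big)\ge k\,d^\gamma(x)\qquad\text{for all }x\in\Omega\cap B_\delta(\overline x);$$ (4) $F$ satisfies the Strong Maximum Principle in $\Omega$. If $u\in USC(\Omega)$ is a viscosity subsolution of $F[u]=0$ in $\Omega$ satisfying $$\limsup_{x\to\partial\Omega}\frac{u(x)}{-\log d(x)}\le 0,$$ then $u$ is constant.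
   Context: $\Omega\subset\mathbb R^n$ is a bounded connected open set with $C^2$ boundary. $d$ is the signed distance $d(x)=\operatorname{dist}(x,\mathbb R^n\setminus\Omega)-\operatorname{dist}(x,\overline\Omega)$, which is of class $C^2$ near $\partial\Omega$; the $\delta$ in (3) is understood small enough that $d$ is $C^2$ where its derivatives are used. $A\subseteq\mathbb R^m$ is closed; $b:\overline\Omega\times A\to\mathbb R^n$ and $a:\overline\Omega\times A\to\mathbb R^{n\times n}$ are bounded and continuous; $a(x,\alpha)$ is symmetric and nonnegative definite, and $a=\sigma\sigma^T$ with $\sigma:\overline\Omega\times A\to\mathbb R^{n\times r}$, $r\ge1$. $|\cdot|$ is the Euclidean norm, also for matrices. The Hamilton-Jacobi-Bellman operator is $$F[u](x)=\sup_{\alpha\in A}\big(-b(x,\alpha)\cdot Du(x)-\operatorname{tr}(a(x,\alpha)D^2u(x))\big).$$ A modulus of continuity is a nonnegative function on $[0,\infty)$, continuous at $0$ with value $0$ at $0$. $USC(\Omega)$ is the set of upper semicontinuous functions on $\Omega$. Strong Maximum Principle for $F$ in $\Omega$: if $u\in USC(\Omega)$ is a viscosity subsolution of $F[u]=0$ in $\Omega$ and there is $x_0\in\Omega$ with $u(x_0)=\max_\Omega u$, then $u$ is constant. *)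

(* Defs.v *)
From HB Require Import structures.
From mathcomp Require Import all_boot all_order all_algebra.
From mathcomp Require Import all_classical all_reals all_analysis.
Import Order.TTheory GRing.Theory Num.Theory.
Import numFieldNormedType.Exports.
Set Implicit Arguments.
Unset Strict Implicit.
Unset Printing Implicit Defensive.
Local Open Scope classical_set_scope.
Local Open Scope ring_scope.

(* The library norm on matrices is the maximum norm; it is used below only for
   topological notions.  All quantitative bounds use the Euclidean (Frobenius)
   norm [enorm].  Points of R^n are row vectors. *)
Definition enorm (R : realType) (p q : nat) (M : 'M[R]_(p, q)) : R :=
  Num.sqrt (\sum_i \sum_j M i j ^+ 2).

Definition dot (R : realType) (n : nat) (v w : 'rV[R]_n) : R :=
  \sum_i v 0 i * w 0 i.

Definition eball (R : realType) (n : nat) (x : 'rV[R]_n) (r : R) : set 'rV[R]_n :=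
  [set y | enorm (y - x) < r].

Definition dist (R : realType) (n : nat) (x : 'rV[R]_n) (S : set 'rV[R]_n) : R :=
  inf [set enorm (x - y) | y in S].

Definition bdry (T : topologicalType) (S : set T) : set T :=
  closure S `\` interior S.

Definition sdist (R : realType) (n : nat) (Omega : set 'rV[R]_n)
    (x : 'rV[R]_n) : R :=
  dist x (~` Omega) - dist x (closure Omega).

Definition partial (R : realType) (n : nat) (i : 'I_n) (f : 'rV[R]_n -> R)
    (x : 'rV[R]_n) : R :=
  'D_(delta_mx 0 i) f x.

Definition grad (R : realType) (n : nat) (f : 'rV[R]_n -> R)
    (x : 'rV[R]_n) : 'rV[R]_n :=
  \row_i partial i f x.

Definition hess (R : realType) (n : nat) (f : 'rV[R]_n -> R)
    (x : 'rV[R]_n) : 'M[R]_n :=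
  \matrix_(i, j) partial i (partial j f) x.

(* Intended for open U: only the values of f on U then matter. *)
Definition C2_on (R : realType) (n : nat) (U : set 'rV[R]_n)
    (f : 'rV[R]_n -> R) : Prop :=
  forall x, U x ->
    [/\ differentiable f x,
        forall j, differentiable (partial j f) x
      & forall i j, {for x, continuous (partial i (partial j f))}].

(* Near each boundary point, after choosing a coordinate x_i and an orientation
   of its axis, Omega is the set above the graph of a C^2 function of the
   remaining coordinates; [col' i x] is x with its i-th coordinate removed. *)
Definition C2_boundary (R : realType) (n : nat) (Omega : set 'rV[R]_n) : Prop :=
  forall xb, bdry Omega xb ->
    exists (rho : R) (i : 'I_n) (s : bool) (g : 'rV[R]_n.-1 -> R),
      [/\ 0 < rho, C2_on setT g
        & forall x, eball xb rho x ->
            (Omega x <-> g (col' i x) < (-1) ^+ s * x 0 i)].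

Definition modulus (R : realType) (w : R -> R) : Prop :=
  [/\ forall t, 0 <= t -> 0 <= w t,
      w 0 = 0
    & w @ within [set t | 0 <= t] (nbhs (0 : R)) --> (0 : R)].

(* USC(Omega), for real-valued u; values of u outside Omega are irrelevant. *)
Definition usc_on (T : topologicalType) (R : realType) (Omega : set T)
    (u : T -> R) : Prop :=
  forall x, Omega x -> forall c, u x < c ->
    \forall y \near within Omega (nbhs x), u y < c.

(* The supremum is taken in the extended reals. *)
Definition HJB (R : realType) (n m : nat) (A : set 'rV[R]_m)
    (b : 'rV[R]_n -> 'rV[R]_m -> 'rV[R]_n)
    (a : 'rV[R]_n -> 'rV[R]_m -> 'M[R]_n)
    (phi : 'rV[R]_n -> R) (x : 'rV[R]_n) : \bar R :=
  ereal_sup [set (- dot (b x alpha) (grad phi x)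
                  - \tr (a x alpha *m hess phi x))%:E | alpha in A].

Definition viscosity_subsolution (R : realType) (n : nat)
    (F : ('rV[R]_n -> R) -> 'rV[R]_n -> \bar R) (Omega : set 'rV[R]_n)
    (u : 'rV[R]_n -> R) : Prop :=
  forall (phi : 'rV[R]_n -> R) (x0 : 'rV[R]_n),
    C2_on Omega phi -> Omega x0 ->
    (\forall y \near within Omega (nbhs x0), u y - phi y <= u x0 - phi x0) ->
    (F phi x0 <= 0)%E.

Definition constant_on (T U : Type) (Omega : set T) (u : T -> U) : Prop :=
  forall x y, Omega x -> Omega y -> u x = u y.

Definition strong_max_principle (R : realType) (n : nat)
    (F : ('rV[R]_n -> R) -> 'rV[R]_n -> \bar R) (Omega : set 'rV[R]_n) : Prop :=
  forall u : 'rV[R]_n -> R,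
    usc_on Omega u -> viscosity_subsolution F Omega u ->
    (exists2 x0, Omega x0 & forall y, Omega y -> u y <= u x0) ->
    constant_on Omega u.

(* The filter on R^n describing x --> bdry Omega with x in Omega. *)
Definition to_bdry (R : realType) (n : nat) (Omega : set 'rV[R]_n) :
    set_system 'rV[R]_n :=
  filter_from [set eta : R | 0 < eta]
    (fun eta => [set x | Omega x /\ dist x (bdry Omega) < eta]).

(* Main.v *)
(* With d the distance to the complement, grad d is constant along the segment
   from x to its nearest boundary point p, so Hoelder continuity gives
   |sigma^T grad d| <= B d^beta at x for the control attached to p.  Hence
   h(d), with h(t) = - ln (1 - max(1 - t/eta, 0)^3) blowing up like - ln t at 0
   and vanishing for t >= eta, is a strict supersolution near the boundary:
   its second-order term is at most of order d^(2 beta - 1) |h'(d)|, dominated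
   by k d^gamma |h'(d)|.  The maximum of u - eps h(d) over Omega is attained,
   because of the growth condition on u, and cannot lie near the boundary;
   letting eps tend to 0, u attains its maximum in the interior. *)
Require Import Defs.
From mathcomp Require Import all_boot all_order all_algebra.
From mathcomp Require Import all_classical all_reals all_analysis.
From mathcomp Require Import ring lra.
Import Order.TTheory GRing.Theory Num.Theory.
Import numFieldNormedType.Exports.
Local Open Scope classical_set_scope.
Local Open Scope ring_scope.

Set Implicit Arguments.
Unset Strict Implicit.

(** * Euclidean norm and distance to a set *)

(** Cauchy-Schwarz through Lagrange's identity: the sum of all [(v i * w j - v j * w i) ^+ 2] is
    twice the difference of the two sides. *)
Lemma sqr_sum_le (R : realType) (I : finType) (v w : I -> R) :
  (\sum_i v i * w i) ^+ 2 <= (\sum_i v i ^+ 2) * (\sum_i w i ^+ 2).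
Proof.
have : 0 <= \sum_i \sum_j (v i * w j - v j * w i) ^+ 2.
  by apply: sumr_ge0 => i _; apply: sumr_ge0 => j _; exact: sqr_ge0.
suff -> : \sum_i \sum_j (v i * w j - v j * w i) ^+ 2 =
    2 * ((\sum_i v i ^+ 2) * (\sum_i w i ^+ 2) - (\sum_i v i * w i) ^+ 2).
  by rewrite pmulr_rge0// subr_ge0.
transitivity (\sum_i \sum_j
    (v i ^+ 2 * w j ^+ 2 + w i ^+ 2 * v j ^+ 2 - 2 * ((v i * w i) * (v j * w j)))).
  by apply: eq_bigr => i _; apply: eq_bigr => j _; ring.
under eq_bigr do rewrite sumrB big_split/= -!mulr_sumr.
rewrite sumrB big_split/= -mulr_sumr -!mulr_suml.
ring.
Qed.

Section EuclideanNorm.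
Context {R : realType}.

Lemma enorm_ge0 p q (M : 'M[R]_(p, q)) : 0 <= enorm M.
Proof. exact: sqrtr_ge0. Qed.

Lemma sqr_enorm p q (M : 'M[R]_(p, q)) :
  enorm M ^+ 2 = \sum_(k : 'I_p * 'I_q) M k.1 k.2 ^+ 2.
Proof.
rewrite sqr_sqrtr; first by rewrite pair_bigA.
by apply: sumr_ge0 => i _; apply: sumr_ge0 => j _; exact: sqr_ge0.
Qed.

Lemma enormD p q (M N : 'M[R]_(p, q)) : enorm (M + N) <= enorm M + enorm N.
Proof.
rewrite -(@ler_pXn2r _ 2) ?nnegrE ?addr_ge0 ?enorm_ge0//.
have MN : \sum_(k : 'I_p * 'I_q) M k.1 k.2 * N k.1 k.2 <= enorm M * enorm N.
  apply: le_trans (ler_norm _) _.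
  rewrite -(@ler_pXn2r _ 2) ?nnegrE ?mulr_ge0 ?enorm_ge0// real_normK ?num_real//.
  by rewrite exprMn !sqr_enorm; exact: sqr_sum_le.
rewrite sqrrD !sqr_enorm.
under eq_bigr do rewrite mxE sqrrD.
rewrite 2!big_split/= lerD2r lerD2l sumrMnl ler_wMn2r//.
Qed.

Lemma enormZ p q (c : R) (M : 'M[R]_(p, q)) : enorm (c *: M) = `|c| * enorm M.
Proof.
apply/eqP; rewrite -(@eqrXn2 _ 2) ?mulr_ge0 ?enorm_ge0//.
rewrite exprMn !sqr_enorm real_normK ?num_real// mulr_sumr.
by apply/eqP/eq_bigr => k _; rewrite mxE exprMn.
Qed.

Lemma enormN p q (M : 'M[R]_(p, q)) : enorm (- M) = enorm M.
Proof. by rewrite -scaleN1r enormZ normrN1 mul1r. Qed.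

Lemma enormB p q (M N : 'M[R]_(p, q)) : enorm (M - N) = enorm (N - M).
Proof. by rewrite -enormN opprB. Qed.

Lemma enorm0 p q : enorm (0 : 'M[R]_(p, q)) = 0.
Proof. by rewrite -(scale0r 0) enormZ normr0 mul0r. Qed.

Lemma norm_coord_le_enorm p q (M : 'M[R]_(p, q)) i j : `|M i j| <= enorm M.
Proof.
rewrite -(@ler_pXn2r _ 2) ?nnegrE ?enorm_ge0// real_normK ?num_real// sqr_enorm.
rewrite (bigD1 (i, j))//= lerDl; apply: sumr_ge0 => k _; exact: sqr_ge0.
Qed.

Lemma norm_le_enorm p q (M : 'M[R]_(p, q)) : `|M| <= enorm M.
Proof.
rewrite [leLHS]mx_normrE; apply: bigmax_le; first exact: enorm_ge0.
by move=> k _; exact: norm_coord_le_enorm.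
Qed.

Lemma norm_coord_le_norm p q (M : 'M[R]_(p, q)) i j : `|M i j| <= `|M|.
Proof.
rewrite [leRHS]mx_normrE; exact: (le_bigmax _ (fun k => `|M k.1 k.2|) (i, j)).
Qed.

(** The crude constant avoids a square root; the bound only serves to prove continuity in the
    library topology. *)
Lemma enorm_le_norm p q (M : 'M[R]_(p, q)) : enorm M <= (p * q)%:R * `|M|.
Proof.
rewrite -(@ler_pXn2r _ 2) ?nnegrE ?enorm_ge0 ?mulr_ge0// sqr_enorm.
apply: (@le_trans _ _ (\sum_(k : 'I_p * 'I_q) `|M| ^+ 2)).
  apply: ler_sum => k _; rewrite -(@real_normK _ (M _ _)) ?num_real//.
  by rewrite ler_pXn2r ?nnegrE// norm_coord_le_norm.
rewrite sumr_const card_prod !card_ord -[leLHS]mulr_natl exprMn.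
rewrite ler_wpM2r ?sqr_ge0// -natrX ler_nat.
by case: (p * q)%N => // k; exact: leq_pmull.
Qed.

Lemma enorm_eq0 p q (M : 'M[R]_(p, q)) : enorm M = 0 -> M = 0.
Proof. by move=> M0; apply/eqP; rewrite -normr_le0 -M0 norm_le_enorm. Qed.

Lemma dotE n (v w : 'rV[R]_n) : v *m w^T = (dot v w)%:M.
Proof.
apply/matrixP => i j; rewrite !ord1 !mxE eqxx mulr1n.
by apply: eq_bigr => k _; rewrite mxE.
Qed.

Lemma dotZr n (c : R) (v w : 'rV[R]_n) : dot v (c *: w) = c * dot v w.
Proof. by rewrite /dot mulr_sumr; apply: eq_bigr => i _; rewrite mxE; ring. Qed.

Lemma dotvv n (v : 'rV[R]_n) : dot v v = enorm v ^+ 2.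
Proof.
rewrite /enorm sqr_sqrtr big_ord1 ?sumr_ge0// => i _; exact: sqr_ge0.
Qed.

Lemma enormBZ n (v w : 'rV[R]_n) (c : R) :
  enorm (v - c *: w) ^+ 2 =
  enorm v ^+ 2 - 2 * c * dot v w + c ^+ 2 * enorm w ^+ 2.
Proof.
rewrite -!dotvv /dot !mulr_sumr -sumrB -big_split/=.
by apply: eq_bigr => i _; rewrite !mxE; ring.
Qed.

Lemma enorm_mulmx n r (v : 'rV[R]_n) (M : 'M[R]_(n, r)) :
  enorm (v *m M) <= enorm v * enorm M.
Proof.
rewrite -(@ler_pXn2r _ 2) ?nnegrE ?mulr_ge0 ?enorm_ge0// exprMn -!dotvv.
rewrite sqr_enorm -(pair_bigA _ (fun i j => M i j ^+ 2))/= exchange_big/=.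
rewrite mulr_sumr; apply: ler_sum => j _; rewrite -expr2 mxE.
exact: sqr_sum_le.
Qed.

(** Cyclicity of the trace. With [M] the diffusion factor and [v] the gradient of the distance, this
    is the term carrying the second derivative of the barrier. *)
Lemma mxtrace_mul_tr n r (v : 'rV[R]_n) (M : 'M[R]_(n, r)) :
  \tr (M *m M^T *m (v^T *m v)) = enorm (v *m M) ^+ 2.
Proof.
rewrite mulmxA mxtrace_mulC mulmxA mulmxA -mulmxA -trmx_mul dotE dotvv.
by rewrite mxtrace_scalar mulr1n.
Qed.

End EuclideanNorm.

Lemma lipschitz_bound_continuous (R : realType) (V : normedModType R) (f : V -> R)
    (C : R) : 0 <= C -> (forall x y, `|f x - f y| <= C * `|x - y|) -> continuous f.
Proof.
move=> C0 fC x; apply/cvgrPdist_lt => e e0.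
(* [C] may be zero, so the radius is [e / (C + 1)]. *)
have C1 : 0 < C + 1 by rewrite ltr_wpDl.
apply/nbhs_normP; exists (e / (C + 1)) => /=; first by rewrite divr_gt0.
move=> y /=; rewrite ltr_pdivlMr// mulrC; apply: le_lt_trans.
by apply: le_trans (fC _ _) _; rewrite ler_wpM2r// lerDl.
Qed.

(** * Distance to a set *)

Section Distance.
Context {R : realType} {n : nat}.
Implicit Types (x y : 'rV[R]_n) (S : set 'rV[R]_n).

Let dist_lb x S : has_lbound [set enorm (x - y) | y in S].
Proof. by exists 0 => _ [y _ <-]; exact: enorm_ge0. Qed.

Lemma dist_ge0 x S : 0 <= dist x S.
Proof.
(* The infimum of the empty set is 0 by default, so the distance to the empty set is 0. *)
have [->|/set0P[y Sy]] := eqVneq S set0; first by rewrite /dist image_set0 inf0.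
by apply: lb_le_inf; [exists (enorm (x - y)), y|move=> _ [z _ <-]; exact: enorm_ge0].
Qed.

Lemma dist_le x S y : S y -> dist x S <= enorm (x - y).
Proof. by move=> Sy; apply: ge_inf; [exact: dist_lb|exists y]. Qed.

Lemma dist_mem x S : S x -> dist x S = 0.
Proof.
move=> Sx; apply/eqP; rewrite eq_le dist_ge0 andbT.
by apply: le_trans (dist_le x Sx) _; rewrite subrr enorm0.
Qed.

Lemma dist_lipschitz x y S : dist x S <= dist y S + enorm (x - y).
Proof.
have [->|/set0P[z Sz]] := eqVneq S set0.
  by rewrite /dist !image_set0 inf0 add0r enorm_ge0.
rewrite -lerBlDr; apply: lb_le_inf; first by exists (enorm (y - z)), z.
move=> _ [t St <-]; rewrite lerBlDr; apply: le_trans (dist_le x St) _.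
by rewrite [leRHS]addrC -[x - t](subrKA y) enormD.
Qed.

Lemma dist_continuous S : continuous (fun y : 'rV[R]_n => dist y S).
Proof.
apply: (@lipschitz_bound_continuous _ _ _ (1 * n)%:R) => // x y.
apply: le_trans (enorm_le_norm (x - y)).
have := dist_lipschitz x y S; have := dist_lipschitz y x S.
by rewrite (enormB y x) => h1 h2; rewrite ler_norml; lra.
Qed.

Lemma enormB_continuous x : continuous (fun y : 'rV[R]_n => enorm (y - x)).
Proof.
apply: (@lipschitz_bound_continuous _ _ _ (1 * n)%:R) => // y z.
apply: le_trans (enorm_le_norm (y - z)).
have := enormD (y - z) (z - x); have := enormD (z - y) (y - x).
by rewrite !subrKA (enormB z y) => h1 h2; rewrite ler_norml; lra.
Qed.

End Distance.

(** The nonempty sets of points of [K] with [f y <= f x] are nested, hence generate a proper filter,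
    which clusters at some [p] in [K]. If [f p < f y], semicontinuity gives a neighbourhood of [p]
    where [f] stays below [f y], yet it must meet the set attached to [y]. *)
Lemma usc_compact_max (T : topologicalType) (R : realType) (D K : set T)
    (f : T -> R) :
  usc_on D f -> compact K -> K `<=` D -> K !=set0 ->
  exists2 p, K p & forall y, K y -> f y <= f p.
Proof.
move=> uf cK KD [y0 Ky0].
pose F := filter_from K (fun y => K `&` [set x | f y <= f x]).
have FF : Filter F.
  apply: filter_from_filter; first by exists y0.
  move=> y z Ky Kz; have [fyz|/ltW fzy] := leP (f y) (f z).
    by exists z => // x [Kx /= fzx]; split; split=> //=; exact: le_trans fzx.
  by exists y => // x [Kx /= fyx]; split; split=> //=; exact: le_trans fyx.
have PF : ProperFilter F.
  by apply: filter_from_proper => // y Ky; exists y; split=> /=.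
have [|p [Kp clp]] := cK F PF; first by exists y0 => // x [].
exists p => // y Ky; rewrite leNgt; apply/negP => fpy.
have [|z [[Kz /= fyz] fz]] := clp (K `&` [set x | f y <= f x]) _ _ (uf p (KD _ Kp) _ fpy).
  by exists y.
by have := fz (KD _ Kz); rewrite ltNge fyz.
Qed.

(** Only points of [C] no farther from [x] than [q] compete; they form a compact set, on which minus
    the distance to [x] has a maximum. *)
Lemma nearest_point (R : realType) n (C : set 'rV[R]_n) x :
  closed C -> C !=set0 -> exists2 p, C p & enorm (x - p) = dist x C.
Proof.
move=> cC [q Cq].
pose f y : R := - enorm (y - x).
have cf := @enormB_continuous _ _ x.
pose K := C `&` [set y | enorm (y - x) <= enorm (q - x)].
have cK : compact K.
  apply: bounded_closed_compact; last first.
    apply: closedI => //; apply: (preimage_closed (D := [set t | t <= enorm (q - x)])).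
      by move=> y _; exact: cf.
    exact: closed_le.
  exists (enorm (q - x) + enorm x); split; first exact: num_real.
  move=> M /ltW leM y [Cy /= yq].
  apply: le_trans (norm_le_enorm _) _; apply: le_trans leM.
  rewrite -[y](subrK x); apply: le_trans (enormD _ _) _.
  by rewrite lerD2r.
have [|//||p [Cp qp] pmax] := @usc_compact_max _ _ setT K f _ cK.
- move=> y _ c; rewrite /f ltrNl => /(cvgr_gt _ (cf y)).
  by apply: (@filterS _ (nbhs y)) => z /= cz _; rewrite ltrNl.
- by exists q; split=> /=.
exists p => //; apply/eqP; rewrite eq_le dist_le// andbT.
apply: lb_le_inf; first by exists (enorm (x - q)), q.
move=> _ [y Cy <-]; rewrite (enormB x p) (enormB x y).
have [qy|/ltW yq] := leP (enorm (q - x)) (enorm (y - x)).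
  exact: le_trans (qp : enorm (p - x) <= _) qy.
by rewrite -lerN2; exact: pmax.
Qed.

(** * Gradient of the signed distance *)

Lemma cvg_near_cst_eq (R : realType) (T : Type) (F : set_system T)
    {PF : ProperFilter F} (f : T -> R) (l c : R) :
  f x @[x --> F] --> l -> (\forall x \near F, f x = c) -> l = c.
Proof.
move=> fl fc; apply/eqP; rewrite eq_le.
by rewrite (cvgr_to_le fl) ?(cvgr_to_ge fl)//; apply: filterS fc => x ->.
Qed.

Section SignedDistance.
Context {R : realType} {n : nat} (Omega : set 'rV[R]_n).
Hypothesis Omega_open : open Omega.
Implicit Types x y p v : 'rV[R]_n.
Local Notation d := (fun x => dist x (~` Omega)).

Lemma sdist_dist x : Omega x -> sdist Omega x = d x.
Proof.
by move=> Ox; rewrite /sdist (dist_mem (S := closure Omega)) ?subr0//; exact: subset_closure.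
Qed.

Lemma dist_compl_gt0_mem x : 0 < d x -> Omega x.
Proof. by move=> dx; apply: contrapT => Ox; rewrite dist_mem ?ltxx in dx. Qed.

Lemma dist_compl_gt0 x : ~` Omega !=set0 -> Omega x -> 0 < d x.
Proof.
move=> C0 Ox; rewrite lt_neqAle dist_ge0 andbT eq_sym; apply/eqP => dx0.
have [p Op] := nearest_point x (open_closedC Omega_open) C0.
by rewrite dx0 => /enorm_eq0 /subr0_eq xp; apply: Op; rewrite -xp.
Qed.

(** The point [p] itself gives the upper bound, and the Lipschitz estimate between [x] and the point
    of the segment gives the lower one. *)
Lemma dist_ray (S : set 'rV[R]_n) x p t : S p -> enorm (x - p) = dist x S ->
  0 <= t <= 1 -> dist (p + t *: (x - p)) S = t * dist x S.
Proof.
move=> Sp xp /andP[t0 t1]; apply/eqP; rewrite eq_le; apply/andP; split.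
  apply: le_trans (dist_le _ Sp) _.
  by rewrite addrC addKr enormZ ger0_norm// xp.
have := dist_lipschitz x (p + t *: (x - p)) S.
have -> : x - (p + t *: (x - p)) = (1 - t) *: (x - p).
  by rewrite scalerBl scale1r opprD addrA.
by rewrite enormZ xp ger0_norm ?subr_ge0//; lra.
Qed.

Lemma ray_cvg p v : p + t *: v @[t --> (0 : R)^'+] --> p.
Proof.
have : p + t *: v @[t --> (0 : R)] --> p + (0 : R) *: v.
  by apply: cvgD; [exact: cvg_cst|apply: cvgZr_tmp; exact: cvg_id].
by rewrite scale0r addr0; exact: cvg_at_right_filter.
Qed.

Lemma near0_unit_interval : \forall t \near (0 : R)^'+, 0 < t <= 1.
Proof.
near=> t; apply/andP; split; near: t; first exact: nbhs_right_gt.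
exact: nbhs_right_le.
Unshelve. all: by end_near. Qed.

(** Points of the segment towards [x] have positive distance to the complement, so they lie in
    [Omega], and they tend to [p]. *)
Lemma nearest_point_bdry x p : Omega x -> ~ Omega p -> enorm (x - p) = d x ->
  bdry Omega p.
Proof.
move=> Ox Op xp; split; last by move=> /interior_subset.
move=> B pB.
have := @ray_cvg p (x - p) _ pB => rB.
have [t [Bt t01]] : exists t, B (p + t *: (x - p)) /\ 0 < t <= 1.
  apply: (@filter_ex _ (0 : R)^'+); apply: filterI; first exact: rB.
  exact: near0_unit_interval.
exists (p + t *: (x - p)); split=> //; apply: dist_compl_gt0_mem.
have /andP[t0 t1] := t01.
rewrite (dist_ray (S := ~` Omega))// ?(ltW t0)// pmulr_rgt0//.
by apply: dist_compl_gt0 => //; exists p.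
Qed.

Lemma derive_dot (f : 'rV[R]_n -> R) x v : differentiable f x ->
  'D_v f x = dot v (grad f x).
Proof.
move=> df; rewrite deriveE// {1}(row_sum_delta v) linear_sum.
by apply: eq_bigr => i _; rewrite linearZ mxE /partial deriveE.
Qed.

(** The distance is 1-Lipschitz. The derivative exists, so right difference quotients suffice; for
    small steps the point stays in the open [Omega]. *)
Lemma derive_sdist_le x v : Omega x -> differentiable (sdist Omega) x ->
  'D_v (sdist Omega) x <= enorm v.
Proof.
move=> Ox df.
have dv : derivable (sdist Omega) x v by exact: diff_derivable.
have /cvg_dnbhs_at_right cv := dv.
have xO := @ray_cvg x v Omega (open_nbhs_nbhs (conj Omega_open Ox)).
apply: (cvgr_to_le cv); near=> t.
have t0 : 0 < t by near: t; exact: nbhs_right_gt.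
have Ot : Omega (t *: v + x).
  by rewrite addrC; near: t; exact: xO.
rewrite /= !sdist_dist// [leLHS]mulrC ler_pdivrMr// lerBlDl.
apply: le_trans (dist_lipschitz _ x _) _.
by rewrite addrK enormZ gtr0_norm// mulrC.
Unshelve. all: by end_near. Qed.

(* To the left of [x] on the line through [p], the distance is linear with slope 1. *)
Lemma derive_sdist_nearest x p : Omega x -> ~ Omega p -> enorm (x - p) = d x ->
  differentiable (sdist Omega) x -> 'D_(x - p) (sdist Omega) x = d x.
Proof.
move=> Ox Op xp df.
have dv : derivable (sdist Omega) x (x - p) by exact: diff_derivable.
have /cvg_dnbhs_at_left cv := dv.
apply: (cvg_near_cst_eq cv); near=> t.
have t0 : t < 0 by near: t; exact: nbhs_left_lt.
have t1 : -1 < t by near: t; apply: nbhs_left_gt; rewrite ltrN10.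
rewrite /=; have -> : t *: (x - p) + x = p + (1 + t) *: (x - p).
  by rewrite scalerDl scale1r addrA [p + _]addrC subrK addrC.
have dr : d (p + (1 + t) *: (x - p)) = (1 + t) * d x.
  by rewrite (dist_ray (S := ~` Omega))//; apply/andP; split; lra.
have Or : Omega (p + (1 + t) *: (x - p)).
  apply: dist_compl_gt0_mem; rewrite dr pmulr_rgt0; last lra.
  by apply: dist_compl_gt0 => //; exists p.
rewrite !sdist_dist// dr /GRing.scale/=; field; lra.
Unshelve. all: by end_near. Qed.

(** Equality case of Cauchy-Schwarz: with [|x - p| = d], [(x - p) . g = d] and [|g| <= 1], the
    square of [|x - p - d g|] is at most [d^2 - 2 d^2 + d^2 = 0]. *)
Lemma grad_sdist x p : Omega x -> ~ Omega p -> enorm (x - p) = d x ->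
  differentiable (sdist Omega) x ->
  enorm (grad (sdist Omega) x) <= 1 /\ x - p = d x *: grad (sdist Omega) x.
Proof.
move=> Ox Op xp df; set g := grad _ x.
(* The derivative in the direction of [g] itself gives [|g|^2 <= |g|]. *)
have g1 : enorm g <= 1.
  have := derive_sdist_le g Ox df; rewrite derive_dot// dotvv expr2.
  have := enorm_ge0 g; rewrite le_eqVlt => /predU1P[<-//|g0].
  by rewrite ger_pMr.
split=> //; apply/subr0_eq/enorm_eq0/eqP; rewrite -sqrf_eq0 eq_le sqr_ge0 andbT.
rewrite enormBZ -derive_dot// derive_sdist_nearest// xp.
have g2 : enorm g ^+ 2 <= 1 by rewrite -(expr1n _ 2) ler_pXn2r ?nnegrE ?enorm_ge0.
have := sqr_ge0 (d x); nra.
Qed.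

Lemma enorm_grad_sdist x p : Omega x -> ~ Omega p -> enorm (x - p) = d x ->
  differentiable (sdist Omega) x -> enorm (grad (sdist Omega) x) = 1.
Proof.
move=> Ox Op xp df; have [_ /(congr1 (@enorm R 1 n))] := grad_sdist Ox Op xp df.
have d0 : 0 < d x by apply: dist_compl_gt0 => //; exists p.
by rewrite enormZ xp gtr0_norm// -[LHS]mulr1 => /(mulfI (lt0r_neq0 d0)).
Qed.

(* The gradient is constant on the segment from [x] to its nearest boundary
   point [p], and continuous at [p]. *)
Lemma grad_sdist_bdry x p (delta : R) : Omega x -> ~ Omega p ->
  enorm (x - p) = d x -> d x < delta -> C2_on (eball p delta) (sdist Omega) ->
  grad (sdist Omega) p = grad (sdist Omega) x.
Proof.
move=> Ox Op xp xdelta dC2.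
have d0 : 0 < d x by apply: dist_compl_gt0 => //; exists p.
have pB : eball p delta p by rewrite /eball/= subrr enorm0 (lt_trans d0).
have gx t : 0 < t <= 1 ->
    grad (sdist Omega) (p + t *: (x - p)) = grad (sdist Omega) x.
  move=> /andP[t0 t1].
  have dr : d (p + t *: (x - p)) = t * d x.
    by apply: dist_ray => //; rewrite t1 ltW.
  have Or : Omega (p + t *: (x - p)).
    by apply: dist_compl_gt0_mem; rewrite dr mulr_gt0.
  have rp : enorm (p + t *: (x - p) - p) = d (p + t *: (x - p)).
    by rewrite dr addrC addKr enormZ gtr0_norm// xp.
  have rB : eball p delta (p + t *: (x - p)).
    rewrite /eball/= rp dr; apply: le_lt_trans xdelta.
    by rewrite ler_piMl// ltW.
  have [dfr _ _] := dC2 _ rB.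
  have xB : eball p delta x by rewrite /eball/= xp.
  have [dfx _ _] := dC2 _ xB.
  have [_ gr] := grad_sdist Or Op rp dfr.
  have [_ gx] := grad_sdist Ox Op xp dfx.
  (* Both gradients solve [t *: (x - p) = (t * d x) *: _], and the scalar is nonzero. *)
  move: gr; rewrite addrC addKr dr {1}gx scalerA => /esym/scalerI; apply.
  by rewrite mulf_neq0// lt0r_neq0.
apply/rowP => j; rewrite !mxE.
have [_ /(_ j) /differentiable_continuous cj _] := dC2 _ pB.
have := cvg_comp _ _ (@ray_cvg p (x - p)) cj => cr.
apply: (cvg_near_cst_eq cr); apply: filterS near0_unit_interval => t /gx.
by move=> /rowP /(_ j); rewrite !mxE.
Qed.

End SignedDistance.

(** * Functions of class C2 *)

Lemma open_near (T : topologicalType) (U : set T) (P : T -> Prop) x :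
  open U -> U x -> (forall y, U y -> P y) -> nbhs x P.
Proof.
move=> oU Ux UP; have : nbhs x U by exact: open_nbhs_nbhs.
exact: filterS.
Qed.

Lemma near_eq_continuous (T T' : topologicalType) (f g : T -> T') x :
  (\forall y \near x, f y = g y) -> {for x, continuous f} -> {for x, continuous g}.
Proof.
move=> fg; rewrite /prop_for /continuous_at -(nbhs_singleton fg).
by apply: cvg_trans; exact: near_eq_cvg.
Qed.

(** The first-order expansion of [f] at [x] is also one of [g]; uniqueness of the differential then
    identifies ['d g x] with ['d f x]. *)
Lemma differentiable_near_eq (R : numFieldType) (V W : normedModType R)
    (f g : V -> W) (x : V) :
  (\forall y \near x, f y = g y) -> differentiable f x -> differentiable g x.
Proof.
move=> fg df.
have dfc : continuous ('d f x) by exact: diff_continuous.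
have eg : g \o shift x = cst (g x) + 'd f x +o_ (0 : V) id.
  apply/eqaddoP => e e0.
  have /eqaddoP/(_ e e0) := diff_locally df.
  have fg0 : \forall h \near (0 : V), f (h + x) = g (h + x).
    by move: fg; rewrite (near_shift 0 x (fun y => f y = g y)) subr0.
  apply: filterS2 fg0 => h fgh.
  rewrite /cst /shift /= !fctE /= fgh.
  by have /nbhs_singleton -> := fg.
apply/diff_locallyP; have dgf := diff_unique dfc eg.
by rewrite dgf; split.
Qed.

(** Serves to differentiate the square of a positive part at its kink: one remainder bound replaces
    the two one-sided limits. *)
Lemma is_derive_quadratic (R : realType) (f : R -> R) (x c K : R) : 0 <= K ->
  (forall h, `|f (x + h) - f x - c * h| <= K * h ^+ 2) -> is_derive x 1 f c.
Proof.
move=> K0 fK.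
have cv : h^-1 *: ((f \o shift x) (h *: 1) - f x) @[h --> (0 : R)^'] --> c.
  apply/cvgrPdist_le => e e0; near=> h.
  have h0 : h != 0 by near: h; exact: nbhs_dnbhs_neq.
  have he : `|h| < e / (K + 1).
    near: h; apply: nbhs_dnbhs; apply/nbhs_normP; exists (e / (K + 1)).
      by rewrite /= divr_gt0// ltr_wpDl.
    by move=> h /=; rewrite sub0r normrN.
  rewrite /= /GRing.scale/= mulr1 [h + x]addrC.
  have -> : c - h^-1 * (f (x + h) - f x) = - (h^-1 * (f (x + h) - f x - c * h)).
    by field.
  rewrite normrN normrM normfV mulrC ler_pdivrMr ?normr_gt0//.
  apply: le_trans (fK h) _; rewrite -(real_normK (num_real h)) expr2 mulrA.
  rewrite ler_wpM2r// mulrC; apply: (@le_trans _ _ (`|h| * (K + 1))).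
    by rewrite ler_wpM2l// lerDl.
  by rewrite -ler_pdivlMr ?ltW// ltr_wpDl.
apply: DeriveDef; first by apply/cvg_ex; exists c.
exact: cvg_lim cv.
Unshelve. all: by end_near. Qed.

Section C2.
Context {R : realType} {n : nat}.
Implicit Types (f g : 'rV[R]_n -> R) (U : set 'rV[R]_n).

Lemma partial_open_eq U f g i x : open U -> (forall y, U y -> f y = g y) -> U x ->
  partial i f x = partial i g x.
Proof.
move=> oU fg Ux; apply: near_eq_derive.
exact (@open_near _ U (fun y => f y = g y) x oU Ux fg).
Qed.

Lemma differentiable_open_eq U f g x : open U -> (forall y, U y -> f y = g y) -> U x ->
  differentiable f x -> differentiable g x.
Proof.
move=> oU fg Ux; apply: differentiable_near_eq.
exact (@open_near _ U (fun y => f y = g y) x oU Ux fg).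
Qed.

Lemma continuous_open_eq U f g x : open U -> (forall y, U y -> f y = g y) -> U x ->
  {for x, continuous f} -> {for x, continuous g}.
Proof.
move=> oU fg Ux; apply: near_eq_continuous.
exact (@open_near _ U (fun y => f y = g y) x oU Ux fg).
Qed.

Lemma C2_on_eq U f g : open U -> (forall y, U y -> f y = g y) -> C2_on U f -> C2_on U g.
Proof.
move=> oU fg fC2 x Ux; have [df dpf cf] := fC2 x Ux.
have pfg j : forall y, U y -> partial j f y = partial j g y.
  by move=> y Uy; exact: (partial_open_eq j oU fg Uy).
split=> [|j|i j].
- exact: (differentiable_open_eq oU fg Ux df).
- exact: (differentiable_open_eq oU (pfg j) Ux (dpf j)).
- apply: (continuous_open_eq oU _ Ux (cf i j)) => y Uy.
  exact: (partial_open_eq i oU (pfg j) Uy).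
Qed.

Lemma partial_cst i (c : R) : partial i (cst c : 'rV[R]_n -> R) = cst 0.
Proof. by apply/funext => x; exact: derive_cst. Qed.

Lemma C2_on_cst U (c : R) : C2_on U (cst c).
Proof.
move=> x _; split=> [|j|i j]; rewrite ?partial_cst.
- exact: differentiable_cst.
- exact: differentiable_cst.
- exact: cst_continuous.
Qed.

Lemma differentiable_comp1 (h : R -> R) (c : R) f x :
  differentiable f x -> is_derive (f x) 1 h c -> differentiable (h \o f) x.
Proof.
move=> df [dh _]; apply: differentiable_comp => //.
exact/derivable1_diffP.
Qed.

Lemma partial_comp (h : R -> R) (c : R) f x i :
  differentiable f x -> is_derive (f x) 1 h c ->
  partial i (h \o f) x = c * partial i f x.
Proof.
move=> df hc; have dhf := differentiable_comp1 df hc.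
have [dh hE] := hc.
have dh' : differentiable h (f x) by exact/derivable1_diffP.
by rewrite /partial !deriveE// diff_comp//= diff1E//= derive1E hE mulrC.
Qed.

Lemma partialM f g x i : differentiable f x -> differentiable g x ->
  partial i (f \* g) x = f x * partial i g x + g x * partial i f x.
Proof. by move=> df dg; apply: deriveM; exact: diff_derivable. Qed.

(** * Chain rule to second order for a scalar function of a C2 function *)

Section Composition.
Variables (U : set 'rV[R]_n) (f : 'rV[R]_n -> R) (h h1 h2 : R -> R).
Hypotheses (U_open : open U) (f_C2 : C2_on U f).
Hypothesis h_derive : forall x, U x -> is_derive (f x) 1 h (h1 (f x)).
Hypothesis h1_derive : forall x, U x -> is_derive (f x) 1 h1 (h2 (f x)).

Lemma grad_comp x : U x -> grad (h \o f) x = h1 (f x) *: grad f x.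
Proof.
move=> Ux; have [df _ _] := f_C2 Ux.
by apply/rowP => i; rewrite !mxE (partial_comp _ df (h_derive Ux)).
Qed.

Let partial_comp_in j :
  forall x, U x -> ((h1 \o f) \* partial j f) x = partial j (h \o f) x.
Proof.
move=> x Ux; have [df _ _] := f_C2 Ux.
by rewrite (partial_comp _ df (h_derive Ux)).
Qed.

(** The formula for the first partials holds on all of the open [U], so it may be differentiated
    again by the product rule. *)
Let partial2_comp i j x : U x -> partial i (partial j (h \o f)) x =
  h1 (f x) * partial i (partial j f) x +
  h2 (f x) * (partial i f x * partial j f x).
Proof.
move=> Ux; have [df dpf _] := f_C2 Ux.
rewrite -(partial_open_eq i U_open (@partial_comp_in j) Ux).
have dh1 := differentiable_comp1 df (h1_derive Ux).
rewrite partialM// (partial_comp _ df (h1_derive Ux)).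
by congr (_ + _); rewrite mulrC -mulrA.
Qed.

Lemma hess_comp x : U x -> hess (h \o f) x =
  h1 (f x) *: hess f x + h2 (f x) *: ((grad f x)^T *m grad f x).
Proof.
move=> Ux; apply/matrixP => i j; rewrite !mxE big_ord1 !mxE.
exact: partial2_comp.
Qed.

Lemma C2_on_comp : (forall x, U x -> {for f x, continuous h2}) ->
  C2_on U (h \o f).
Proof.
move=> ch2 x Ux; have [df dpf cf] := f_C2 Ux.
have dh1 := differentiable_comp1 df (h1_derive Ux).
split=> [|j|i j].
- exact: differentiable_comp1 (h_derive Ux).
- apply: (differentiable_open_eq U_open (@partial_comp_in j) Ux).
  exact: differentiableM.
- apply: (continuous_open_eq (U := U)
    (f := fun x => h1 (f x) * partial i (partial j f) x +
                   h2 (f x) * (partial i f x * partial j f x))) => //.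
    by move=> y Uy; rewrite partial2_comp.
  have c0 := differentiable_continuous df.
  have c1 : {for x, continuous (fun x => h1 (f x) * partial i (partial j f) x)}.
    apply: continuousM; first exact: differentiable_continuous dh1.
    exact: cf.
  have c2 : {for x, continuous (fun x => partial i f x * partial j f x)}.
    by apply: continuousM; exact: differentiable_continuous (dpf _).
  have c3 : {for x, continuous (fun x => h2 (f x))}.
    exact: continuous_comp c0 (ch2 _ Ux).
  exact: (continuousD c1 (continuousM c3 c2)).
Qed.

End Composition.
End C2.

(** * The barrier *)

Section Barrier.
Context {R : realType}.
Implicit Types x t : R.

Lemma is_derive_maxr0_sqr x :
  is_derive x 1 (fun x => Num.max x 0 ^+ 2) (2 * Num.max x 0).
Proof.
apply: (@is_derive_quadratic _ _ _ _ 1) => // h; rewrite mul1r ler_norml.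
(* In each of the four sign cases the remainder lies between 0 and [h ^+ 2]. *)
by have [x0|x0] := leP x 0; have [xh0|xh0] := leP (x + h) 0; nra.
Qed.

Lemma is_derive_maxr0_cube x :
  is_derive x 1 (fun x => Num.max x 0 ^+ 3) (3 * Num.max x 0 ^+ 2).
Proof.
have -> : (fun x => Num.max x 0 ^+ 3) = id * (fun x : R => Num.max x 0 ^+ 2).
  by apply/funext => y; rewrite !fctE; case: (leP y 0) => y0; ring.
have sq := is_derive_maxr0_sqr x.
apply: is_derive_eq; rewrite /GRing.scale/= mulr1.
by case: (leP x 0) => x0; ring.
Qed.

Variable eta : R.
Hypothesis eta_gt0 : 0 < eta.

Definition cutoff t : R := Num.max (1 - t / eta) 0.
(** The cube makes the function C2 across [t = eta], where it is glued to zero; a square would leave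
    a jump in the second derivative. *)
Definition barrier t : R := - ln (1 - cutoff t ^+ 3).
(** This and [barrier2] are closed forms of the first and second derivatives of [barrier] at
    positive arguments. *)
Definition barrier1 t : R := - (3 / eta) * (cutoff t ^+ 2 / (1 - cutoff t ^+ 3)).
Definition barrier2 t : R :=
  6 / eta ^+ 2 * (cutoff t / (1 - cutoff t ^+ 3)) +
  9 / eta ^+ 2 * (cutoff t ^+ 4 / (1 - cutoff t ^+ 3) ^+ 2).

Lemma cutoff_itv t : 0 < t -> 0 <= cutoff t < 1.
Proof.
move=> t0; have te : 0 < t / eta by rewrite divr_gt0.
by rewrite /cutoff; case: (leP (1 - t / eta) 0) => ?; apply/andP; split; lra.
Qed.

Lemma cutoff_cube_lt1 t : 0 < t -> 0 < 1 - cutoff t ^+ 3.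
Proof.
move=> /cutoff_itv /andP[q0 q1]; rewrite subr_gt0; exact: exprn_ilt1.
Qed.

Lemma is_derive_affine t : is_derive t 1 (fun t => 1 - t / eta) (- eta^-1).
Proof.
have -> : (fun t => 1 - t / eta) = cst 1 - eta^-1 \*: id.
  by apply/funext => s; rewrite !fctE /GRing.scale/= mulrC.
apply: is_derive_eq. by rewrite [LHS]sub0r /GRing.scale/= mulr1.
Qed.

Lemma is_derive_cutoff_sqr t :
  is_derive t 1 (fun t => cutoff t ^+ 2) (- (2 / eta) * cutoff t).
Proof.
apply: is_derive_eq (is_derive1_comp (is_derive_maxr0_sqr _) (is_derive_affine t)) _.
by rewrite /cutoff; field; rewrite lt0r_neq0.
Qed.

Lemma is_derive_cutoff_cube t :
  is_derive t 1 (fun t => 1 - cutoff t ^+ 3) (3 / eta * cutoff t ^+ 2).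
Proof.
have c3 := is_derive1_comp (is_derive_maxr0_cube _) (is_derive_affine t).
have -> : (fun t => 1 - cutoff t ^+ 3) =
    cst 1 - (fun x => Num.max x 0 ^+ 3) \o (fun t => 1 - t / eta).
  by apply/funext.
apply: is_derive_eq; rewrite /cutoff /GRing.scale/=; field; rewrite lt0r_neq0//.
Qed.

Lemma is_derive_barrier t : 0 < t -> is_derive t 1 barrier (barrier1 t).
Proof.
move=> t0; have s0 := cutoff_cube_lt1 t0.
have lnd := is_derive1_comp (g := fun t => 1 - cutoff t ^+ 3)
  (is_derive1_ln s0) (is_derive_cutoff_cube t).
have -> : barrier = - (@ln R \o (fun t => 1 - cutoff t ^+ 3)) by apply/funext.
apply: is_derive_eq; rewrite /barrier1; field.
by rewrite !lt0r_neq0.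
Qed.

Lemma is_derive_barrier1 t : 0 < t -> is_derive t 1 barrier1 (barrier2 t).
Proof.
move=> t0; have s0 := cutoff_cube_lt1 t0.
have dV := is_deriveV (f := fun t => 1 - cutoff t ^+ 3) (lt0r_neq0 s0) (is_derive_cutoff_cube t).
have d2 := is_derive_cutoff_sqr t.
have -> : barrier1 = - (3 / eta) \*: ((fun t => cutoff t ^+ 2) *
    (fun t => (1 - cutoff t ^+ 3)^-1)) by apply/funext.
apply: is_derive_eq; rewrite /barrier2 /GRing.scale/=; field.
by rewrite !lt0r_neq0.
Qed.

Lemma cutoff_continuous : continuous cutoff.
Proof.
apply: (@lipschitz_bound_continuous _ _ _ eta^-1); first by rewrite invr_ge0 ltW.
suff le_cutoff (x y : R) : `|cutoff x - cutoff y| <= eta^-1 * `|x - y| by [].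
have -> : eta^-1 * `|x - y| = `|x / eta - y / eta|.
  by rewrite -mulrBl normrM normfV (gtr0_norm eta_gt0) mulrC.
rewrite /cutoff; move: (x / eta) (y / eta) => s t.
by case: (leP (1 - s) 0) => s1; case: (leP (1 - t) 0) => t1;
  case: (ger0P (s - t)) => st; rewrite ler_norml; lra.
Qed.

Lemma barrier2_continuous t : 0 < t -> {for t, continuous barrier2}.
Proof.
move=> /cutoff_cube_lt1/lt0r_neq0 s0.
have cq : {for t, continuous cutoff} by exact: cutoff_continuous.
have cqn k : {for t, continuous (fun t => cutoff t ^+ k)}.
  exact: continuous_comp cq (@exprn_continuous _ _ _).
have cs : {for t, continuous (fun t => 1 - cutoff t ^+ 3)}.
  by apply: continuousB (cqn 3%N); exact: cst_continuous.
apply: continuousD; apply: continuousM; try exact: cst_continuous.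
  by apply: continuousM => //; apply: continuousV.
apply: continuousM => //; apply: continuousV; first by rewrite sqrf_eq0.
exact: continuous_comp cs (@exprn_continuous _ _ _).
Qed.

Lemma barrier_ge0 t : 0 < t -> 0 <= barrier t.
Proof.
move=> t0; rewrite oppr_ge0 ln_le0// gerBl exprn_ge0//.
by have /andP[] := cutoff_itv t0.
Qed.

Lemma cutoff_eq0 t : eta <= t -> cutoff t = 0.
Proof.
move=> et; rewrite /cutoff max_r// subr_le0 ler_pdivlMr// mul1r//.
Qed.

Lemma barrier_eq0 t : eta <= t -> barrier t = 0.
Proof. by move=> et; rewrite /barrier cutoff_eq0// expr0n/= subr0 ln1 oppr0. Qed.

(* [1 - q ^ 3 <= 3 (1 - q)], so the barrier blows up at least like [- ln t]. *)
Lemma barrier_ge t : 0 < t -> - ln (3 / eta) - ln t <= barrier t.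
Proof.
move=> t0; have s0 := cutoff_cube_lt1 t0.
have e0 : 0 < 3 / eta by rewrite divr_gt0.
rewrite -opprD -lnM ?posrE// lerN2 ler_ln ?posrE ?mulr_gt0 ?invr_gt0//.
have /andP[q0 q1] := cutoff_itv t0.
have te : 0 < t / eta by rewrite divr_gt0.
rewrite mulrAC -mulrA; move: q0 q1 te; rewrite /cutoff; move: (t / eta) => s.
by case: (leP (1 - s) 0) => s1 *; nra.
Qed.

Lemma barrier1_lt0 t : 0 < t < eta -> barrier1 t < 0.
Proof.
move=> /andP[t0 te]; have s0 := cutoff_cube_lt1 t0.
rewrite /barrier1 mulNr oppr_lt0 mulr_gt0 ?divr_gt0// exprn_gt0//.
by rewrite /cutoff lt_max subr_gt0 ltr_pdivrMr// mul1r te.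
Qed.

Lemma barrier2_ge0 t : 0 < t -> 0 <= barrier2 t.
Proof.
move=> t0; have s0 := cutoff_cube_lt1 t0; have /andP[q0 _] := cutoff_itv t0.
have e2 : 0 < eta ^+ 2 by rewrite exprn_gt0.
by rewrite addr_ge0// mulr_ge0// divr_ge0// ?exprn_ge0// ltW.
Qed.

(** For [- ln t] the second derivative is minus the first divided by [t]; the barrier keeps this up
    to a factor 3. With [q] the cutoff and [t = eta * (1 - q)], the difference has the sign of
    [2 q^3 + 3 q^2 + 3 q - 2], which is positive for [q >= 1/2], that is for [t <= eta / 2]. *)
Lemma barrier2_le t : 0 < t <= eta / 2 -> barrier2 t <= 3 * - barrier1 t / t.
Proof.
move=> /andP[t0 te]; have s0 := cutoff_cube_lt1 t0.
have q12 : 1 / 2 <= cutoff t.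
  by rewrite /cutoff le_max lerBrDl -lerBrDr ler_pdivrMr//; apply/orP; left; lra.
have qE : t = eta * (1 - cutoff t).
  have : cutoff t = 1 - t / eta.
    by rewrite /cutoff max_l// subr_ge0 ler_pdivrMr// mul1r; lra.
  by move=> ->; field; rewrite lt0r_neq0.
have q1 : 0 < 1 - cutoff t by rewrite subr_gt0; have /andP[] := cutoff_itv t0.
rewrite /barrier2 /barrier1; move: (cutoff t) q12 q1 s0 qE => q q12 q1 s0 ->.
rewrite -subr_ge0.
have -> : 3 * - (- (3 / eta) * (q ^+ 2 / (1 - q ^+ 3))) / (eta * (1 - q)) -
    (6 / eta ^+ 2 * (q / (1 - q ^+ 3)) + 9 / eta ^+ 2 * (q ^+ 4 / (1 - q ^+ 3) ^+ 2))
  = 3 * q / (eta ^+ 2 * (1 - q ^+ 3) ^+ 2) * (2 * q ^+ 3 + 3 * q ^+ 2 + 3 * q - 2).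
  by field; rewrite !lt0r_neq0.
apply: mulr_ge0; last nra.
by rewrite divr_ge0 ?mulr_ge0 ?exprn_ge0 ?(ltW eta_gt0) ?(ltW s0)//; lra.
Qed.

End Barrier.

(** * The barrier composed with the distance *)

(** Here [t] is the distance, [h1] and [h2] are the barrier derivatives, [K] is the left side of the
    boundary condition and [G] is the norm of [sigma^T Dd]. The term [h2 * G ^+ 2] is at most
    [- h1 * t^gamma] times [3 * B^2 * t^(2 beta - 1 - gamma)], and the last factor is below [k]. *)
Lemma barrier_gap (R : realType) (k B beta gamma K G t h1 h2 : R) :
  0 < t -> 0 < B -> 3 * B ^+ 2 * t `^ (2 * beta - 1 - gamma) < k ->
  k * t `^ gamma <= K -> 0 <= G <= B * t `^ beta ->
  h1 < 0 -> h2 <= 3 * - h1 / t -> 0 <= h2 ->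
  0 < - h1 * K - h2 * G ^+ 2.
Proof.
move=> t0 B0 tk kK /andP[G0 GB] h10 h2t h20.
have tb : (t `^ beta) ^+ 2 = t `^ (2 * beta - 1 - gamma) * t `^ gamma * t.
  rewrite -powR_mulrn ?powR_ge0// -powRrM.
  rewrite -[X in _ = _ * X](powRr1 (ltW t0)) -!powRD ?lt0r_neq0 ?implybT//.
  by congr (_ `^ _); ring.
have G2 : G ^+ 2 <= B ^+ 2 * (t `^ beta) ^+ 2.
  by rewrite -exprMn ler_pXn2r ?nnegrE// (le_trans G0).
have tg : 0 < t `^ gamma by exact: powR_gt0.
apply: (@lt_le_trans _ _ (- h1 * (k * t `^ gamma) -
    3 * - h1 / t * (B ^+ 2 * (t `^ beta) ^+ 2))).
  have -> : - h1 * (k * t `^ gamma) - 3 * - h1 / t * (B ^+ 2 * (t `^ beta) ^+ 2)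
    = - h1 * t `^ gamma * (k - 3 * B ^+ 2 * t `^ (2 * beta - 1 - gamma)).
    by rewrite tb; field; rewrite lt0r_neq0.
  by rewrite mulr_gt0 ?subr_gt0// mulr_gt0// oppr_gt0.
apply: lerB; first by rewrite ler_wpM2l// oppr_ge0 ltW.
by apply: ler_pM => //; exact: sqr_ge0.
Qed.

Lemma powR_small (R : realType) (C k e : R) : 0 < C -> 0 < k -> 0 < e ->
  exists2 t0, 0 < t0 & forall t, 0 < t < t0 -> C * t `^ e < k.
(* The threshold is the solution of [C * t^e = k]. *)
Proof.
move=> C0 k0 e0; exists ((k / C) `^ e^-1); first by rewrite powR_gt0// divr_gt0.
move=> t /andP[t0 tt]; rewrite mulrC -ltr_pdivlMr//.
have <- : ((k / C) `^ e^-1) `^ e = k / C.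
  by rewrite -powRrM mulVf ?lt0r_neq0// powRr1// divr_ge0// ltW.
by apply: gt0_ltr_powR => //; rewrite nnegrE ?powR_ge0 ?ltW.
Qed.

Lemma usc_onB (R : realType) (T : topologicalType) (D : set T) (u f : T -> R) :
  usc_on D u -> (forall x, D x -> {for x, continuous f}) ->
  usc_on D (fun x => u x - f x).
Proof.
move=> uu cf x Dx c uc; pose e := (c - (u x - f x)) / 2.
have e2 : e + e = c - (u x - f x) by rewrite -splitr.
have e0 : 0 < e by rewrite divr_gt0// subr_gt0.
have fx : \forall y \near within D (nbhs x), f x - e < f y.
  apply: cvg_within; apply: (cvgr_gt _ (cf x Dx)); lra.
have ux := uu x Dx (u x + e) ltac:(lra).
by apply: filterS2 fx ux => y /= fy uy; lra.
Qed.

(** A vector with all entries [|M| + 2] exceeds the bound [|M| + 1]. For [n = 0] the space is a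
    single point, hence the positivity of [n]. *)
Lemma exists_notin_bounded (R : realType) n (S : set 'rV[R]_n) :
  (0 < n)%N -> bounded_set S -> ~` S !=set0.
Proof.
move=> n0 [M [_ SM]]; exists (const_mx (`|M| + 2)) => SC.
have := SM (`|M| + 1); rewrite (le_lt_trans (ler_norm M)) ?ltrDl// => /(_ isT _ SC).
apply/negP; rewrite -ltNge; apply: (@lt_le_trans _ _ (`|M| + 2)); first by rewrite ltrD2l ltr1n.
case: n n0 S SM SC => // n _ S SM SC.
apply: le_trans (norm_coord_le_norm _ ord0 ord0).
by rewrite mxE [leRHS]ger0_norm ?addr_ge0.
Qed.

(** * The collar of the boundary and the barrier as a C2 test function *)

Section Comparison.
Context {R : realType} {n : nat} (Omega : set 'rV[R]_n).
Hypotheses (Omega_open : open Omega) (Omega_bounded : bounded_set Omega).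
Hypothesis (compl_nonempty : ~` Omega !=set0).
Implicit Types x y p v : 'rV[R]_n.
Local Notation d := (fun x => dist x (~` Omega)).

Lemma near_bdry_point x : Omega x ->
  exists p, [/\ ~ Omega p, bdry Omega p & enorm (x - p) = d x].
Proof.
move=> Ox; have [p Op xp] := nearest_point x (open_closedC Omega_open) compl_nonempty.
by exists p; split=> //; apply: nearest_point_bdry xp.
Qed.

(** Links the distance to the complement with the distance to the boundary, in which [to_bdry] is
    phrased. *)
Lemma dist_bdry_le x : Omega x -> dist x (bdry Omega) <= d x.
Proof. by move=> /near_bdry_point [p [_ bp <-]]; exact: dist_le. Qed.

Lemma compact_dist_ge (c : R) : 0 < c -> compact [set x | c <= d x].
Proof.
move=> c0; apply: bounded_closed_compact; last first.
  apply: (@preimage_closed _ _ d [set t | c <= t]); last exact: closed_ge.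
  by move=> x _; exact: dist_continuous.
have [M [Mr OM]] := Omega_bounded.
exists M; split=> // N MN x /= cx; apply: (OM N MN).
by apply: dist_compl_gt0_mem; exact: lt_le_trans cx.
Qed.

Lemma eball_open x (r : R) : open (eball x r).
Proof.
rewrite (_ : eball x r = (fun y => enorm (y - x)) @^-1` [set t | t < r])//.
apply: open_comp; last exact: open_lt.
by move=> y _; exact: enormB_continuous.
Qed.

Section BarrierOfDistance.
Variables (delta eta eps : R).
Hypotheses (eta_gt0 : 0 < eta) (eta_delta : eta < delta).
Hypothesis sdist_C2 : forall p, bdry Omega p -> C2_on (eball p delta) (sdist Omega).

Definition dist_barrier := (fun t => eps * barrier eta t) \o sdist Omega.

Let is_derive_scale (f : R -> R) (c t : R) :
  is_derive t 1 f c -> is_derive t 1 (fun t => eps * f t) (eps * c).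
Proof. by move=> fc; exact: (is_deriveZ (f := f)). Qed.

(** The ball makes [sdist] C2, and [Omega] keeps it positive, where the barrier derivatives are
    available. *)
Let collar p := Omega `&` eball p delta.

Let collar_open p : open (collar p).
Proof. by apply: openI => //; exact: eball_open. Qed.

Let collar_C2 p : bdry Omega p -> C2_on (collar p) (sdist Omega).
Proof. by move=> bp x [_ xp]; exact: sdist_C2 bp _ xp. Qed.

Let sdist_gt0 x : Omega x -> 0 < sdist Omega x.
Proof. by move=> Ox; rewrite sdist_dist//; exact: dist_compl_gt0. Qed.

Let derive1 p x : collar p x -> is_derive (sdist Omega x) 1
  (fun t => eps * barrier eta t) (eps * barrier1 eta (sdist Omega x)).
Proof.
by move=> [/sdist_gt0 Ox _]; apply: is_derive_scale; exact: is_derive_barrier.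
Qed.

Let derive2 p x : collar p x -> is_derive (sdist Omega x) 1
  (fun t => eps * barrier1 eta t) (eps * barrier2 eta (sdist Omega x)).
Proof.
by move=> [/sdist_gt0 Ox _]; apply: is_derive_scale; exact: is_derive_barrier1.
Qed.

(** Two open regions cover [Omega] because [eta < delta]: where [d < delta] the chain rule applies
    in the collar of a nearest boundary point, and where [d > eta] the function is zero. *)
Lemma dist_barrier_C2 : C2_on Omega dist_barrier.
Proof.
move=> x Ox; have [xdelta|deltax] := ltP (d x) delta.
  have [p [_ bp xp]] := near_bdry_point Ox.
  have Cx : collar p x by split=> //; rewrite /eball/= xp.
  have c2 y : collar p y -> {for sdist Omega y, continuous (fun t => eps * barrier2 eta t)}.
    move=> [/sdist_gt0 Oy _]; apply: continuousM; first exact: cst_continuous.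
    exact: barrier2_continuous.
  exact: (C2_on_comp (@collar_open p) (collar_C2 bp) (@derive1 p) (@derive2 p) c2 Cx).
pose V := [set y | eta < d y].
have oV : open V.
  apply: (@open_comp _ _ d [set t | eta < t]); last exact: open_gt.
  by move=> y _; exact: dist_continuous.
apply: (C2_on_eq oV _ (@C2_on_cst _ _ V 0)); last exact: lt_le_trans deltax.
move=> y Vy; have Oy : Omega y by apply: dist_compl_gt0_mem; exact: lt_trans Vy.
by rewrite /dist_barrier/= sdist_dist// barrier_eq0 ?mulr0// ltW.
Qed.

Lemma grad_hess_dist_barrier p x : bdry Omega p -> Omega x -> eball p delta x ->
  grad dist_barrier x = (eps * barrier1 eta (sdist Omega x)) *: grad (sdist Omega) x /\
  hess dist_barrier x = (eps * barrier1 eta (sdist Omega x)) *: hess (sdist Omega) x +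
    (eps * barrier2 eta (sdist Omega x)) *:
      ((grad (sdist Omega) x)^T *m grad (sdist Omega) x).
Proof.
move=> bp Ox px; have Cx : collar p x by [].
split.
  exact: (grad_comp (h1 := fun t => eps * barrier1 eta t)
    (collar_C2 bp) (@derive1 p) Cx).
exact: (hess_comp (h1 := fun t => eps * barrier1 eta t)
  (h2 := fun t => eps * barrier2 eta t)
  (@collar_open p) (collar_C2 bp) (@derive1 p) (@derive2 p) Cx).
Qed.

End BarrierOfDistance.

End Comparison.

Lemma HJB_gt0 (R : realType) (n m : nat) (A : set 'rV[R]_m)
    (b : 'rV[R]_n -> 'rV[R]_m -> 'rV[R]_n) (a : 'rV[R]_n -> 'rV[R]_m -> 'M[R]_n)
    phi x alpha : A alpha ->
  0 < - dot (b x alpha) (grad phi x) - \tr (a x alpha *m hess phi x) ->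
  (0 < HJB A b a phi x)%E.
Proof.
move=> Aa pos; apply: (@lt_le_trans _ _
  (- dot (b x alpha) (grad phi x) - \tr (a x alpha *m hess phi x))%:E).
  by rewrite lte_fin.
by apply: ereal_sup_ubound; exists alpha.
Qed.

Lemma growth_bound (R : realType) (n : nat) (Omega : set 'rV[R]_n)
    (u : 'rV[R]_n -> R) (e : R) : open Omega -> ~` Omega !=set0 -> 0 < e ->
  (limf_esup (fun x => (u x / - ln (sdist Omega x))%:E) (to_bdry Omega) <= 0)%E ->
  exists2 rho, 0 < rho & forall x, Omega x -> dist x (~` Omega) < rho ->
    u x <= e * - ln (dist x (~` Omega)).
Proof.
move=> oO C0 e0 ulim.
have : (limf_esup (fun x => (u x / - ln (sdist Omega x))%:E) (to_bdry Omega) < e%:E)%E.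
  by apply: le_lt_trans ulim _; rewrite lte_fin.
move=> /ereal_inf_lt [_ [V [rho /= rho0 rhoV] <-] supV].
(* The cap 1 makes [- ln d] positive, so that the quotient bound can be multiplied out. *)
exists (Num.min rho 1); first by rewrite lt_min rho0 ltr01.
move=> x Ox; rewrite lt_min => /andP[xrho x1].
have Vx : V x.
  by apply: rhoV; split=> //; apply: le_lt_trans xrho; exact: dist_bdry_le.
have L0 : 0 < - ln (dist x (~` Omega)).
  by rewrite oppr_gt0 ln_lt0// x1 andbT; exact: dist_compl_gt0.
rewrite -ler_pdivrMr// -lee_fin -{1}(sdist_dist Ox); apply: le_trans (ltW supV).
by apply: ereal_sup_ubound; exists x.
Qed.

(** * Strict supersolution property near the boundary *)

Section StrictSupersolution.
Context {R : realType} {n m r : nat} (Omega : set 'rV[R]_n) (A : set 'rV[R]_m).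
Variables (b : 'rV[R]_n -> 'rV[R]_m -> 'rV[R]_n).
Variables (a : 'rV[R]_n -> 'rV[R]_m -> 'M[R]_n).
Variables (sigma : 'rV[R]_n -> 'rV[R]_m -> 'M[R]_(n, r)).
Hypotheses (Omega_open : open Omega) (compl_nonempty : ~` Omega !=set0).
Hypothesis a_sigma : forall x alpha, closure Omega x -> A alpha ->
  a x alpha = sigma x alpha *m (sigma x alpha)^T.
Variables (beta B : R).
Hypothesis B_gt0 : 0 < B.
Hypothesis sigma_holder : forall x y alpha,
  closure Omega x -> closure Omega y -> A alpha ->
  enorm (sigma x alpha - sigma y alpha) <= B * enorm (x - y) `^ beta.
Variables (delta k gamma : R).
Hypothesis sdist_C2 : forall xb, bdry Omega xb ->
  C2_on (eball xb delta) (sdist Omega).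
Hypothesis bdry_condition : forall xb, bdry Omega xb ->
  exists2 alphab, A alphab &
    (sigma xb alphab)^T *m (grad (sdist Omega) xb)^T = 0 /\
    forall x, Omega x -> eball xb delta x ->
      dot (b x alphab) (grad (sdist Omega) x)
      + \tr (a x alphab *m hess (sdist Omega) x)
      >= k * sdist Omega x `^ gamma.

(** The control attached to the nearest boundary point [p] already makes the expression under the
    supremum positive: up to the factor [eps], it is the quantity estimated in [barrier_gap]. *)
Lemma dist_barrier_strict (eta eps : R) x : 0 < eta -> eta < delta -> 0 < eps ->
  Omega x -> dist x (~` Omega) <= eta / 2 ->
  3 * B ^+ 2 * dist x (~` Omega) `^ (2 * beta - 1 - gamma) < k ->
  (0 < HJB A b a (dist_barrier Omega eta eps) x)%E.
Proof.
move=> eta0 eta_delta eps0 Ox xeta tk.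
have [p [Op bp xp]] := near_bdry_point Omega_open compl_nonempty Ox.
have t0 : 0 < dist x (~` Omega) by exact: dist_compl_gt0.
have pB : eball p delta x by rewrite /eball/= xp; lra.
have [alpha Aalpha [sg0 kle]] := bdry_condition bp.
have [dx _ _] := sdist_C2 bp pB.
have gE : grad (sdist Omega) p = grad (sdist Omega) x.
  by apply: grad_sdist_bdry (sdist_C2 bp) => //; lra.
have [gradE hessE] := grad_hess_dist_barrier Omega_open compl_nonempty eps eta0 sdist_C2 bp Ox pB.
have clx : closure Omega x by exact: subset_closure.
have clp : closure Omega p by case: bp.
apply: (HJB_gt0 Aalpha); rewrite gradE hessE.
move: (kle x Ox pB); rewrite sdist_dist// -gE.
set g := grad _ p; set t := dist x _; set H := hess _ x => kle'.
have g1 : enorm g = 1 by rewrite /g gE; exact: enorm_grad_sdist xp dx.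
have gs : g *m sigma p alpha = 0.
  by apply: trmx_inj; rewrite trmx_mul sg0 trmx0.
have G0 : 0 <= enorm (g *m sigma x alpha) <= B * t `^ beta.
  (* The subtracted zero is [g *m sigma p alpha], which brings in the Hoelder bound between [x] and
     [p]. *)
  rewrite enorm_ge0/= -[g *m _]subr0 -gs -mulmxBr.
  apply: le_trans (enorm_mulmx _ _) _; rewrite g1 mul1r.
  by apply: le_trans (sigma_holder clx clp Aalpha) _; rewrite xp.
have h1 : barrier1 eta t < 0 by apply: barrier1_lt0 => //; apply/andP; split; lra.
have h2 : barrier2 eta t <= 3 * - barrier1 eta t / t.
  by apply: barrier2_le => //; rewrite t0.
have h20 := barrier2_ge0 eta0 t0.
have trE : \tr (a x alpha *m (g^T *m g)) = enorm (g *m sigma x alpha) ^+ 2.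
  by rewrite a_sigma// mxtrace_mul_tr.
have := barrier_gap t0 B_gt0 tk kle' G0 h1 h2 h20.
rewrite dotZr mulmxDr -!scalemxAr mxtraceD !mxtraceZ trE.
by rewrite -(pmulr_rgt0 _ eps0); congr (_ < _); ring.
Qed.

End StrictSupersolution.

(** * The theorem *)

Unset Implicit Arguments.

Theorem theorem2p1 (R : realType) (n m r : nat) (Omega : set 'rV[R]_n)
    (A : set 'rV[R]_m)
    (b : 'rV[R]_n -> 'rV[R]_m -> 'rV[R]_n)
    (a : 'rV[R]_n -> 'rV[R]_m -> 'M[R]_n)
    (sigma : 'rV[R]_n -> 'rV[R]_m -> 'M[R]_(n, r))
    (n_gt0 : (0 < n)%N) (r_gt0 : (0 < r)%N)
    (Omega_bounded : bounded_set Omega)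
    (Omega_connected : connected Omega)
    (Omega_open : open Omega)
    (Omega_C2 : C2_boundary Omega)
    (A_closed : closed A)
    (b_bounded : exists M : R, forall x alpha,
       closure Omega x -> A alpha -> enorm (b x alpha) <= M)
    (a_bounded : exists M : R, forall x alpha,
       closure Omega x -> A alpha -> enorm (a x alpha) <= M)
    (b_continuous : {within closure Omega `*` A,
       continuous (fun p : 'rV[R]_n * 'rV[R]_m => b p.1 p.2)})
    (a_continuous : {within closure Omega `*` A,
       continuous (fun p : 'rV[R]_n * 'rV[R]_m => a p.1 p.2)})
    (a_symmetric : forall x alpha, closure Omega x -> A alpha ->
       (a x alpha)^T = a x alpha)
    (a_nonneg : forall x alpha, closure Omega x -> A alpha ->
       forall xi : 'rV[R]_n, 0 <= dot xi (xi *m a x alpha))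
    (a_sigma : forall x alpha, closure Omega x -> A alpha ->
       a x alpha = sigma x alpha *m (sigma x alpha)^T)
    (omega : R -> R) (omega_modulus : modulus omega)
    (b_modulus : forall x y alpha,
       closure Omega x -> closure Omega y -> A alpha ->
       enorm (b x alpha - b y alpha) <= omega (enorm (x - y)))
    (beta B : R) (beta_range : 1 / 2 < beta <= 1) (B_gt0 : 0 < B)
    (sigma_holder : forall x y alpha,
       closure Omega x -> closure Omega y -> A alpha ->
       enorm (sigma x alpha - sigma y alpha) <= B * enorm (x - y) `^ beta)
    (delta k gamma : R) (delta_gt0 : 0 < delta) (k_gt0 : 0 < k)
    (gamma_lt : gamma < 2 * beta - 1)
    (sdist_C2 : forall xb, bdry Omega xb ->
       C2_on (eball xb delta) (sdist Omega))
    (bdry_condition : forall xb, bdry Omega xb ->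
       exists2 alphab, A alphab &
         (sigma xb alphab)^T *m (grad (sdist Omega) xb)^T = 0 /\
         forall x, Omega x -> eball xb delta x ->
           dot (b x alphab) (grad (sdist Omega) x)
           + \tr (a x alphab *m hess (sdist Omega) x)
           >= k * sdist Omega x `^ gamma)
    (smp : strong_max_principle (HJB A b a) Omega)
    (u : 'rV[R]_n -> R)
    (u_usc : usc_on Omega u)
    (u_subsolution : viscosity_subsolution (HJB A b a) Omega u)
    (u_growth :
       (limf_esup (fun x => (u x / - ln (sdist Omega x))%:E) (to_bdry Omega)
        <= 0)%E) :
  constant_on Omega u.
Proof.
have oO := Omega_open.
have C0 := exists_notin_bounded n_gt0 Omega_bounded.
have [t0 t0_gt0 t0k] : exists2 t0, 0 < t0 &
    forall t, 0 < t < t0 -> 3 * B ^+ 2 * t `^ (2 * beta - 1 - gamma) < k.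
  by apply: powR_small => //; [rewrite mulr_gt0// exprn_gt0|rewrite subr_gt0].
move=> x1 x2 Ox1 Ox2.
have d1 := dist_compl_gt0 oO C0 Ox1.
(* The three bounds keep the barrier inside the C2 collar, make it a strict supersolution up to
   distance [eta / 2], and put [x1] into the compact set maximized over next. *)
pose eta := Num.min (delta / 2) (Num.min t0 (dist x1 (~` Omega))).
have eta_gt0 : 0 < eta by rewrite !lt_min divr_gt0// t0_gt0 d1.
have eta_delta : eta < delta.
  by apply: (@le_lt_trans _ _ (delta / 2)); [rewrite ge_min lexx|lra].
have eta_t0 : eta <= t0 by rewrite !ge_min lexx orbT.
have eta_d1 : eta <= dist x1 (~` Omega) by rewrite !ge_min lexx !orbT.
have sub c : 0 < c -> [set x | c <= dist x (~` Omega)] `<=` Omega.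
  by move=> c0 x /= cx; apply: dist_compl_gt0_mem; exact: lt_le_trans cx.
have eta2 : 0 < eta / 2 by rewrite divr_gt0.
have [p pK pmax] : exists2 p, eta / 2 <= dist p (~` Omega) &
    forall y, eta / 2 <= dist y (~` Omega) -> u y <= u p.
  apply: (usc_compact_max u_usc (compact_dist_ge Omega_bounded eta2) (sub _ eta2)).
  by exists x1 => /=; lra.
(* Once [p] is a maximum point over all of [Omega], the strong maximum principle concludes. *)
suff umax z : Omega z -> u z <= u p.
  by apply: (smp u u_usc u_subsolution) => //; exists p => //; exact: sub pK.
move=> Oz.
have dz := dist_compl_gt0 oO C0 Oz.
have M0 := barrier_ge0 eta_gt0 dz.
(* The barrier has a fixed finite value at [z], so [eps] may tend to 0. *)
suff bound eps : 0 < eps -> u z <= u p + eps * barrier eta (dist z (~` Omega)).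
  apply/ler_addgt0Pr => e e0; set M := barrier _ _ in M0 bound.
  have M1 : 0 < M + 1 by lra.
  have := bound (e / (M + 1)) (divr_gt0 e0 M1) => /le_trans; apply.
  rewrite lerD2l mulrAC ler_pdivrMr// ler_wpM2l ?ltW//; lra.
move=> eps0; pose phi := dist_barrier Omega eta eps.
have phiE y : Omega y -> phi y = eps * barrier eta (dist y (~` Omega)).
  by move=> Oy; rewrite /phi /dist_barrier/= sdist_dist.
have phiC2 : C2_on Omega phi.
  exact: (dist_barrier_C2 oO C0 eps eta_gt0 eta_delta sdist_C2).
have usc_v : usc_on Omega (fun y => u y - phi y).
  apply: usc_onB => // y Oy; have [dphi _ _] := phiC2 y Oy.
  exact: differentiable_continuous dphi.
(* Slope [eps / 2] for [u] against [eps] for [phi] leaves half of the logarithm to win with. *)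
have [rho rho0 urho] := growth_bound oO C0 (divr_gt0 eps0 (ltr0n R 2)) u_growth.
(* Near the boundary [u - phi] is at most [eps / 2 * ln d + eps * ln (3 / eta)], and this is below
   [u z - phi z] exactly when [ln d < M]. *)
pose M := 2 / eps * (u z - phi z - eps * ln (3 / eta)).
pose c := Num.min (Num.min rho (expR M)) (dist z (~` Omega)).
have c0 : 0 < c by rewrite !lt_min rho0 expR_gt0.
have cz : c <= dist z (~` Omega) by rewrite ge_min lexx orbT.
have [q qK qmax] : exists2 q, c <= dist q (~` Omega) &
    forall y, c <= dist y (~` Omega) -> u y - phi y <= u q - phi q.
  apply: (usc_compact_max usc_v (compact_dist_ge Omega_bounded c0) (sub _ c0)).
  by exists z.
have Oq : Omega q by exact: sub qK.
have qmax' y : Omega y -> u y - phi y <= u q - phi q.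
  move=> Oy; have [|yc] := leP c (dist y (~` Omega)); first exact: qmax.
  apply: le_trans (qmax z cz).
  have dy := dist_compl_gt0 oO C0 Oy.
  move: yc; rewrite !lt_min => /andP[/andP[yrho yM] _].
  have lnM : ln (dist y (~` Omega)) < M by rewrite -(expRK M) ltr_ln ?posrE ?expR_gt0.
  have := urho y Oy yrho; have := barrier_ge eta_gt0 dy.
  rewrite (phiE y Oy) -(ler_pM2l eps0).
  have : eps / 2 * ln (dist y (~` Omega)) < u z - phi z - eps * ln (3 / eta).
    by rewrite -ltr_pdivlMl ?divr_gt0// invf_div.
  lra.
(* Otherwise [phi], touching [u] from above at [q] up to a constant, would be both a test function
   with [F <= 0] and a strict supersolution there. *)
have q_far : eta / 2 < dist q (~` Omega).
  rewrite ltNge; apply/negP => q_near.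
  have : (HJB A b a phi q <= 0)%E.
    apply: u_subsolution => //; near=> y; apply: qmax'.
    near: y; exact: withinT.
  apply/negP; rewrite -ltNge.
  apply: (dist_barrier_strict oO C0 a_sigma B_gt0 sigma_holder sdist_C2 bdry_condition) => //.
  by apply: t0k; rewrite dist_compl_gt0//=; lra.
(* Chain: [u z - phi z <= u q - phi q <= u q <= u p]. *)
have := qmax' z Oz; rewrite (phiE z Oz).
have := pmax q (ltW q_far).
have : 0 <= phi q.
  rewrite phiE//; apply: mulr_ge0; first exact: ltW.
  by apply: barrier_ge0 => //; exact: dist_compl_gt0.
lra.
Unshelve. all: by end_near. Qed.
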